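(* Let $\Psi=(P,S)$ be a promise problem with $P,S\subseteq\{0,1\}^{2n}$, let $\Pi\subseteq\{0,1\}^\ell$ be a property, and let $\varepsilon,\delta>0$. Suppose the mapping $F\colon\{0,1\}^{2n}\to\{0,1\}^\ell$ satisfies: (i) for every $(x,y)\in P\cap S$, $F(x,y)\in\Pi$; (ii) for every $(x,y)\in P\setminus S$, $F(x,y)$ is $\varepsilon$-far from $\Pi$. Then $Q^{(k)}_\delta(\varepsilon,\Pi)\ge\frac{1}{B+1}\,\mathrm{CC}^{(k+2)}_{2\delta}(\Psi)$, where $B=\max_{i\in[\ell]}\max\big(\overrightarrow{\mathrm{CC}}_{\delta/n}(F_i),\overleftarrow{\mathrm{CC}}_{\delta/n}(F_i)\big)$ and $F_i(x,y)$ is the $i$-th bit of $F(x,y)$. Moreover, if $B'=\max_{i\in[\ell]}\max\big(\overrightarrow{\mathrm{CC}}_0(F_i),\overleftarrow{\mathrm{CC}}_0(F_i)\big)$, then $Q^{(k)}_\delta(\varepsilon,\Pi)\ge\frac{1}{B'+1}\,\mathrm{CC}^{(k+2)}_\delta(\Psi)$.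
   Context: Strings in $\{0,1\}^\ell$ are viewed as functions $[\ell]\to\{0,1\}$; $w$ is $\varepsilon$-far from $\Pi$ if its relative Hamming distance to every element of $\Pi$ exceeds $\varepsilon$. $Q^{(k)}_\delta(\varepsilon,\Pi)$ is the minimum query complexity of a $k$-round-adaptive tester for $\Pi$ with proximity parameter $\varepsilon$ and error probability $\delta$: a randomized algorithm querying coordinates of $w$ in $k+1$ rounds (queries in round $j$ depend on randomness and answers to previous rounds) that accepts $w\in\Pi$ with probability $\ge 1-\delta$ and rejects $\varepsilon$-far $w$ with probability $\ge1-\delta$. In the promise problem $\Psi=(P,S)$, Alice holds $x$, Bob holds $y$, $(x,y)\in P$ is promised, and they must determine whether $(x,y)\in S$. $\mathrm{CC}^{(k)}_\delta(\Psi)$ is the minimum total communication of a public-coin protocol with $k$ rounds (messages) solving $\Psi$ with error at most $\delta$ on every promised input. For a function $G$ of $(x,y)$, $\overrightarrow{\mathrm{CC}}_\delta(G)$ (resp. $\overleftarrow{\mathrm{CC}}_\delta(G)$) is the minimum communication of a public-coin one-way protocol in which Alice sends one message to Bob (resp. Bob to Alice) after which the recipient outputs $G(x,y)$ with error at most $\delta$; $\delta=0$ means zero error. *)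

(* Defs.v *)
From HB Require Import structures.
From mathcomp Require Import all_boot all_order all_algebra.
From mathcomp Require Import boolp reals.

Set Implicit Arguments.
Unset Strict Implicit.
Unset Printing Implicit Defensive.

Import Order.TTheory GRing.Theory Num.Theory.
Local Open Scope ring_scope.

Notation bits n := {ffun 'I_n -> bool}.

(* Least element of a set of naturals; junk value 0 on the empty set.  By the
   lemmas at the end of the file, the empty case does not occur for testers with
   [0 < eps], one-way protocols, or protocols with at least two messages, at any
   error [0 <= delta]. *)
Definition natmin (A : nat -> Prop) : nat :=
  if pselect (exists m, `[< A m >]) is left exA then ex_minn exA else 0%N.

(* Internal randomness and public coins: a finite sample space with arbitrary
   real weights.  A randomized algorithm is then a distribution on deterministic
   ones; finiteness is no loss, since at a given cost there are, up to
   input/output behaviour, finitely many deterministic testers or protocols. *)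
Record coins (R : realType) := Coins {
  outcome :> finType;
  weight : outcome -> R;
  weight_ge0 : forall r, 0 <= weight r;
  weight_sum : \sum_r weight r = 1
}.

Definition Pr (R : realType) (D : coins R) (E : pred D) : R :=
  \sum_(r | E r) weight r.

Section Testing.
Variables (R : realType) (l : nat).

Definition reldist (w u : bits l) : R := #|[set i | w i != u i]|%:R / l%:R.

Definition far (eps : R) (Pi : {set bits l}) (w : bits l) : Prop :=
  forall u, u \in Pi -> eps < reldist w u.

Definition answers (w : bits l) (Q : {set 'I_l}) : {ffun 'I_l -> option bool} :=
  [ffun i => if i \in Q then Some (w i) else None].

(* Deterministic algorithms querying in exactly [m] rounds: each round asks a
   (possibly empty) set of coordinates at once, and the rest of the algorithm
   depends on the answers. *)
Inductive qalg : nat -> Type :=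
| Verdict (b : bool) : qalg 0
| Round m (Q : {set 'I_l}) (next : {ffun 'I_l -> option bool} -> qalg m) :
    qalg m.+1.

Fixpoint qaccepts m (t : qalg m) (w : bits l) : bool :=
  match t with
  | Verdict b => b
  | Round _ Q next => qaccepts (next (answers w Q)) w
  end.

Fixpoint qcount m (t : qalg m) (w : bits l) : nat :=
  match t with
  | Verdict _ => 0
  | Round _ Q next => #|Q| + qcount (next (answers w Q)) w
  end.

Definition has_tester (k : nat) (eps delta : R) (Pi : {set bits l}) (q : nat) :
    Prop :=
  exists (D : coins R) (T : D -> qalg k.+1),
    [/\ forall r w, (qcount (T r) w <= q)%N,
        forall w, w \in Pi -> 1 - delta <= Pr (fun r : D => qaccepts (T r) w)
      & forall w, far eps Pi w ->
          1 - delta <= Pr (fun r : D => ~~ qaccepts (T r) w)].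

Definition query_complexity k eps delta Pi : nat :=
  natmin (has_tester k eps delta Pi).

End Testing.

Section Communication.
Variables (R : realType) (X Y : finType).

(* Yao's protocol trees: the owner of a node sends one bit, and the transcript
   determines the output. *)
Inductive protocol : Type :=
| Output of bool
| Alice of (X -> bool) & protocol & protocol
| Bob of (Y -> bool) & protocol & protocol.

Fixpoint run (t : protocol) (x : X) (y : Y) : bool :=
  match t with
  | Output b => b
  | Alice f t0 t1 => if f x then run t1 x y else run t0 x y
  | Bob g t0 t1 => if g y then run t1 x y else run t0 x y
  end.

Fixpoint cost (t : protocol) : nat :=
  match t with
  | Output _ => 0
  | Alice _ t0 t1 | Bob _ t0 t1 => (maxn (cost t0) (cost t1)).+1
  end.

(* A message is a maximal block of bits sent by one party; [prev] is the sender
   of the previous bit, if any ([true] for Alice, [false] for Bob). *)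
Fixpoint messages (prev : option bool) (t : protocol) : nat :=
  match t with
  | Output _ => 0
  | Alice _ t0 t1 => (prev != Some true) +
      maxn (messages (Some true) t0) (messages (Some true) t1)
  | Bob _ t0 t1 => (prev != Some false) +
      maxn (messages (Some false) t0) (messages (Some false) t1)
  end.

Definition has_protocol (k : nat) (delta : R) (P S : {set X * Y}) (c : nat) :
    Prop :=
  exists (D : coins R) (T : D -> protocol),
    [/\ forall r, (cost (T r) <= c)%N,
        forall r, (messages None (T r) <= k)%N
      & forall x y, (x, y) \in P ->
          Pr (fun r : D => run (T r) x y != ((x, y) \in S)) <= delta].

Definition CC k delta P S : nat := natmin (has_protocol k delta P S).

End Communication.

Section OneWay.
Variable R : realType.

(* The holder of [x : X] sends a [c]-bit message to the holder of [y : Y], who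
   outputs a value for [G x y]. *)
Definition has_oneway (X Y : finType) (delta : R) (G : X -> Y -> bool)
    (c : nat) : Prop :=
  exists (D : coins R) (enc : D -> X -> c.-tuple bool)
         (dec : D -> c.-tuple bool -> Y -> bool),
    forall x y, Pr (fun r : D => dec r (enc r x) y != G x y) <= delta.

Definition CC_to_Bob (X Y : finType) (delta : R) (G : X * Y -> bool) : nat :=
  natmin (has_oneway delta (fun x y => G (x, y))).

Definition CC_to_Alice (X Y : finType) (delta : R) (G : X * Y -> bool) : nat :=
  natmin (has_oneway delta (fun y x => G (x, y))).

End OneWay.

Lemma natminP (A : nat -> Prop) (a : nat) :
  A a -> A (natmin A) /\ forall j, A j -> (natmin A <= j)%N.
Proof.
move=> Aa; rewrite /natmin; case: pselect => [exA|[]]; last first.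
  by exists a; apply/asboolP.
case: ex_minnP => m /asboolP Am minm; split=> // j Aj.
by apply: minm; apply/asboolP.
Qed.

Section NonEmpty.
Variable R : realType.

Lemma unit_weight_sum : \sum_(r : unit) (1 : R) = 1.
Proof. by rewrite big_const card_unit /= addr0. Qed.

Let point : coins R := Coins (fun _ : unit => ler01) unit_weight_sum.

Let Pr_point (E : pred point) : Pr E = (E tt)%:R.
Proof.
rewrite /Pr; case: (boolP (E tt)) => h.
  rewrite (eq_bigl xpredT) ?unit_weight_sum //.
  by case.
by rewrite big1 // => -[]; rewrite (negbTE h).
Qed.

Lemma has_oneway_exists (n : nat) (Y : finType) (delta : R)
    (G : bits n -> Y -> bool) :
  0 <= delta -> has_oneway delta G n.
Proof.
move=> d0; exists point, (fun _ (x : bits n) => [tuple x i | i < n]),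
  (fun _ s y => G [ffun i => tnth s i] y) => x y.
rewrite Pr_point; set x' := finfun _.
by have -> : x' = x; [apply/ffunP=> i; rewrite ffunE tnth_mktuple | rewrite eqxx].
Qed.

Lemma has_tester_exists (l k : nat) (eps delta : R) (Pi : {set bits l}) :
  0 < eps -> 0 <= delta -> has_tester k eps delta Pi l.
Proof.
move=> e0 d0.
pose fix stop b m : qalg l m :=
  if m is m'.+1 then Round set0 (fun _ => stop b m') else Verdict l b.
have stopA b m w : qaccepts (stop b m) w = b by elim: m => //= m ->.
have stopC b m w : qcount (stop b m) w = 0%N by elim: m => //= m ->; rewrite cards0.
pose rd (a : {ffun 'I_l -> option bool}) : bits l := [ffun i => a i == Some true].
have rdK w : rd (answers w setT) = w.
  by apply/ffunP => i; rewrite !ffunE inE; case: (w i).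
exists point, (fun _ => Round setT (fun a => stop (rd a \in Pi) k)).
split=> [_ w|w wP|w wF] /=.
- by rewrite stopC cardsT card_ord addn0.
- by rewrite Pr_point stopA rdK wP lerBlDr lerDl.
- rewrite Pr_point stopA rdK (_ : w \notin Pi) ?lerBlDr ?lerDl //.
  apply/negP => /wF; rewrite /reldist (_ : [set i | _] = set0) ?cards0 ?mul0r.
    by rewrite ltNge ltW.
  by apply/setP => i; rewrite !inE eqxx.
Qed.

Lemma has_protocol_exists (n k : nat) (delta : R)
    (P S : {set bits n * bits n}) :
  0 <= delta -> has_protocol k.+2 delta P S n.+1.
Proof.
move=> d0.
pose fin (s : seq bool) : protocol (bits n) (bits n) :=
  Bob (fun y : bits n => ([ffun i : 'I_n => nth false s i], y) \in S)
      (Output _ _ false) (Output _ _ true).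
pose send := fix send (i : seq 'I_n) (s : seq bool) {struct i} :
    protocol (bits n) (bits n) :=
  if i is j :: i' then
    Alice (fun x : bits n => x j) (send i' (rcons s false)) (send i' (rcons s true))
  else fin s.
have sendC i s : (cost (send i s) <= (size i).+1)%N.
  by elim: i s => //= j i IH s; rewrite ltnS geq_max !IH.
have sendM i s : (messages (Some true) (send i s) <= 1)%N.
  by elim: i s => //= j i IH s; rewrite geq_max !IH.
have sendR i s x y : run (send i s) x y = run (fin (s ++ map x i)) x y.
  elim: i s => [|j i IH] s; first by rewrite cats0.
  by rewrite /= !IH -cat_rcons; case: (x j).
exists point, (fun _ => send (enum 'I_n) [::]); split=> [_|_|x y _].
- by rewrite -[n in (_ <= n.+1)%N]size_enum_ord.
- case: (enum _) => //= j i.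
  apply: (@leq_trans (1 + 1)%N) => //.
  by rewrite leq_add2l geq_max !sendM.
rewrite Pr_point sendR /= (_ : [ffun i => _] = x).
  by case: (_ \in S).
apply/ffunP => i; rewrite ffunE (nth_map i) ?size_enum_ord //.
by rewrite nth_ord_enum.
Qed.

End NonEmpty.

(* Main.v *)
(** A tester with at most [q] queries is simulated by a protocol in which the
    two players take turns.  In each query round, the current sender encodes
    all queried bits of [F (x, y)] with one-way protocols; the receiver decodes
    them and starts the next message by announcing the answers, followed by the
    encodings for the next round.  So [k + 1] query rounds cost [k + 2] messages
    and [B + 1] bits per query.  By a union bound over the queries made on the
    true word [F (x, y)], the simulation adds an error of at most
    [q * (delta / n)], which is at most [delta] when [q <= n]; when [q > n] the
    trivial protocol of cost [n + 1] is already cheap enough. *)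
Require Import Defs.
From mathcomp Require Import all_boot all_order all_algebra.
From mathcomp Require Import reals.

Set Implicit Arguments.
Unset Strict Implicit.
Unset Printing Implicit Defensive.

Import Order.TTheory GRing.Theory Num.Theory.
Local Open Scope ring_scope.

(** * Finite probability: union bound and product spaces *)

Section Probability.
Variable R : realType.
Implicit Types D : coins R.

Lemma le_Pr D (E E' : pred D) : (forall r, E r -> E' r) -> Pr E <= Pr E'.
Proof.
move=> sub; rewrite /Pr [leLHS]big_mkcond [leRHS]big_mkcond /=.
apply: ler_sum => r _; case: ifP => [/sub -> //|_].
by case: ifP => // _; apply: weight_ge0.
Qed.

Lemma Pr_predC D (E : pred D) : Pr E + Pr (fun r => ~~ E r) = 1.
Proof. by rewrite /Pr -(weight_sum D) [in RHS](bigID E). Qed.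

Lemma Pr_or D (E E' : pred D) : Pr (fun r => E r || E' r) <= Pr E + Pr E'.
Proof.
rewrite /Pr !(big_mkcond _ (@weight R D)) /= -big_split /=.
apply: ler_sum => r _; have := weight_ge0 r.
by case: (E r); case: (E' r) => //= w0; rewrite ?addr0 ?add0r // lerDl.
Qed.

Lemma Pr_has D (I : Type) (E : I -> pred D) (e : R) (s : seq I) :
  (forall i, Pr (E i) <= e) ->
  Pr (fun r => has (fun i => E i r) s) <= (size s)%:R * e.
Proof.
move=> Ee; elim: s => [|i s IH] /=; first by rewrite /Pr big_pred0_eq mul0r.
by rewrite (le_trans (Pr_or _ _)) // -natr1 mulrDl mul1r addrC lerD.
Qed.

Lemma prod_weight_ge0 D D' (r : D * D') : 0 <= weight r.1 * weight r.2.
Proof. by rewrite mulr_ge0 ?weight_ge0. Qed.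

Lemma prod_weight_sum D D' : \sum_(r : D * D') weight r.1 * weight r.2 = 1.
Proof.
rewrite -(pair_bigA _ (fun r r' => weight r * weight r')) /=.
by rewrite -big_distrlr /= !weight_sum mulr1.
Qed.

Definition prod_coins D D' : coins R :=
  Coins (@prod_weight_ge0 D D') (prod_weight_sum D D').

Lemma Pr_prod D D' (E : pred (prod_coins D D')) :
  Pr E = \sum_r weight r * Pr (fun r' : D' => E (r, r')).
Proof.
transitivity (\sum_(p : D * D')
    (if E (p.1, p.2) then weight p.1 * weight p.2 else 0)).
  by rewrite /Pr big_mkcond; apply: eq_bigr => -[].
rewrite -(pair_bigA _ (fun r r' => if E (r, r') then weight r * weight r' else 0)).
apply: eq_bigr => r _; rewrite mulr_sumr [in RHS]big_mkcond.
exact: eq_bigr.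
Qed.

(** Conditioning on the first coins: once they are fixed, data that depend on them, such as a list
    of queries, become constants. *)
Lemma Pr_prod_le D D' (E : pred (prod_coins D D')) (e : R) :
  (forall r, Pr (fun r' : D' => E (r, r')) <= e) -> Pr E <= e.
Proof.
move=> Ee; rewrite Pr_prod -[e]mul1r -(weight_sum D) mulr_suml.
by apply: ler_sum => r _; rewrite ler_wpM2l ?weight_ge0.
Qed.

Lemma Pr_prod_fst D D' (E : pred D) :
  Pr (fun r : prod_coins D D' => E r.1) = Pr E.
Proof.
rewrite Pr_prod /Pr [in RHS]big_mkcond; apply: eq_bigr => r _ /=.
by case: (E r); rewrite ?weight_sum ?mulr1 // big_pred0_eq mulr0.
Qed.

(** Each [i] comes with its own sample space; their product serves all [i] at once, because every
    bound concerns a single marginal. The value [a0] fills in when no index is left. *)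
Lemma joint_coins (I : finType) (A Z : Type) (a0 : A) (e : R)
    (bad : I -> A -> Z -> bool) :
  (forall i, exists (D : coins R) (f : D -> A),
     forall z, Pr (fun r : D => bad i (f r) z) <= e) ->
  exists (D : coins R) (f : I -> D -> A),
    forall i z, Pr (fun r : D => bad i (f i r) z) <= e.
Proof.
move=> H; suff [D [f fP]] : exists (D : coins R) (f : I -> D -> A),
    forall i, i \in enum I -> forall z, Pr (fun r : D => bad i (f i r) z) <= e.
  by exists D, f => i; apply: fP; rewrite mem_enum.
elim: (enum I) => [|i s [D [f fP]]].
  by exists (Coins (fun _ : unit => ler01) (unit_weight_sum R)), (fun _ _ => a0).
have [D' [g gP]] := H i.
exists (prod_coins D' D), (fun j r => if j == i then g r.1 else f j r.2).
move=> j; rewrite inE; case: (eqVneq j i) => /= [-> _ z|_ js z].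
  by rewrite (Pr_prod_fst D (fun r => bad i (g r) z)).
by apply: Pr_prod_le => r /=; apply: fP.
Qed.

End Probability.

(** * Monotonicity in message length and error *)

(** The sender pads with [false] and the receiver truncates. This gives all coordinates and both
    directions one common message length. *)
Lemma has_oneway_widen (R : realType) (X Y : finType) (e : R)
    (G : X -> Y -> bool) (c c' : nat) :
  (c <= c')%N -> has_oneway e G c -> has_oneway e G c'.
Proof.
move=> cc' [D [enc [dec H]]].
exists D, (fun r x => [tuple nth false (enc r x) j | j < c']),
  (fun r m y => dec r [tuple nth false m j | j < c] y) => x y.
rewrite [leLHS](_ : _ = Pr (fun r : D => dec r (enc r x) y != G x y)) //.
apply: eq_bigl => r; congr (dec r _ y != _).
apply: eq_from_tnth => j; rewrite tnth_mktuple.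
have jc' : (j < c')%N by apply: leq_trans cc'.
by rewrite -(tnth_nth false _ (Ordinal jc')) tnth_mktuple /= -tnth_nth.
Qed.

Lemma has_protocol_weaken (R : realType) (X Y : finType) (k c : nat)
    (e e' : R) (P S : {set X * Y}) :
  e <= e' -> has_protocol k e P S c -> has_protocol k e' P S c.
Proof.
move=> ee' [D [T [cT mT eT]]]; exists D, T; split=> // x y Pxy.
exact: le_trans (eT x y Pxy) ee'.
Qed.

(** * Simulating a deterministic query algorithm by a protocol tree *)

Section Simulation.
Variables (V : finType) (l B : nat).

(* [true] stands for Alice, as in [messages]. *)
Definition node (d : bool) (f : V -> bool) (t0 t1 : protocol V V) :=
  if d then Alice f t0 t1 else Bob f t0 t1.

Definition inp (d : bool) (x y : V) := if d then x else y.

(** The message reaches the continuation as a function on [K], so that the receiver looks bits up by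
    key; keys outside [s] read as [false]. *)
Fixpoint send (K : finType) (d : bool) (s : seq K) (f : K -> V -> bool)
    (next : {ffun K -> bool} -> protocol V V) : protocol V V :=
  if s is a :: s' then
    let branch b :=
      send d s' f (fun m => next [ffun a' => if a' == a then b else m a']) in
    node d (f a) (branch false) (branch true)
  else next [ffun=> false].

Lemma run_send (K : finType) d (s : seq K) f next x y :
  run (send d s f next) x y =
  run (next [ffun a => (a \in s) && f a (inp d x y)]) x y.
Proof.
elim: s next => [|a s IH] next /=.
  by congr (run (next _) _ _); apply/ffunP => a; rewrite !ffunE.
have -> t0 t1 : run (node d (f a) t0 t1) x y =
    run (if f a (inp d x y) then t1 else t0) x y.
  by case: d {IH} => /=; case: (f a _).
case fa: (f a _); rewrite IH; congr (run (next _) _ _); apply/ffunP => a';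
  by rewrite !ffunE inE; case: eqP => // ->; rewrite fa.
Qed.

Lemma cost_send (K : finType) d (s : seq K) f next c :
  (forall m, (cost (next m) <= c)%N) ->
  (cost (send d s f next) <= size s + c)%N.
Proof.
elim: s next => [|a s IH] next nc //=.
have -> t0 t1 : cost (node d (f a) t0 t1) = (maxn (cost t0) (cost t1)).+1.
  by case: d {IH}.
by rewrite addSn ltnS geq_max !IH.
Qed.

Lemma messages_send (K : finType) d (s : seq K) f next c :
  (forall m, (messages (Some d) (next m) <= c)%N) ->
  (messages (Some d) (send d s f next) <= c)%N.
Proof.
elim: s next => [|a s IH] next nc //=.
have -> t0 t1 : messages (Some d) (node d (f a) t0 t1) =
    maxn (messages (Some d) t0) (messages (Some d) t1) by case: d {IH nc}.
by rewrite geq_max !IH.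
Qed.

(** The previous sender only decides whether the first bit opens a new message. *)
Lemma messages_prev prev d (t : protocol V V) :
  (messages prev t <= (messages (Some d) t).+1)%N.
Proof.
case: t => //= _ t0 t1; rewrite -add1n addnA leq_add2r.
  exact: leq_trans (leq_b1 _) (leq_addr _ _).
exact: leq_trans (leq_b1 _) (leq_addr _ _).
Qed.

Variables (enc : bool -> 'I_l -> V -> B.-tuple bool)
          (dec : bool -> 'I_l -> B.-tuple bool -> V -> bool).

(* The budget [c] keeps the cost bounded after a decoding error: the answers
   may then be inconsistent with every word (the same bit can be queried in two
   directions), so the query bound of the tester no longer applies. *)
Fixpoint simulate m (t : qalg l m) (d : bool) (c : nat) : protocol V V :=
  match t with
  | Verdict b => Output V V b
  | Round _ Q next =>
    if (#|Q| <= c)%N then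
      send d (enum (setX Q [set: 'I_B])) (fun ij v => tnth (enc d ij.1 v) ij.2)
        (fun msg => send (~~ d) (enum Q)
           (fun i v => dec d i [tuple msg (i, j) | j < B] v)
           (fun a => simulate (next [ffun i => if i \in Q then Some (a i) else None])
                              (~~ d) (c - #|Q|)))
    else Output V V false
  end.

(** Each query costs [B] bits of encoding and one bit of announced answer, and takes one unit off
    the budget, whether or not decoding is correct. *)
Lemma cost_simulate m (t : qalg l m) d c :
  (cost (simulate t d c) <= (B + 1) * c)%N.
Proof.
elim: t d c => [b|{}m Q next IH] d c //=; case: ifP => // Qc.
rewrite -[in leqRHS](subnKC Qc) mulnDr mulnDl mul1n -addnA.
rewrite -[B in (B * _)%N]card_ord -cardsT [(#|_| * #|Q|)%N]mulnC -cardsX cardE.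
apply: cost_send => msg; rewrite [X in (_ <= X + _)%N]cardE.
exact: cost_send.
Qed.

(** The encodings prolong the block of [d]; only the change of turn before the announced answers
    opens a message, once per round. *)
Lemma messages_simulate m (t : qalg l m) d c :
  (messages (Some d) (simulate t d c) <= m)%N.
Proof.
elim: t d c => [b|{}m Q next IH] d c //=; case: ifP => // Qc.
apply: messages_send => msg; apply: leq_trans (messages_prev _ (~~ d) _) _.
by rewrite ltnS; apply: messages_send.
Qed.

(** Queries follow the true word rather than the decoded answers, so the list does not depend on the
    coins of the one-way protocols. The direction is recorded because it selects which protocol
    decodes the bit. *)
Fixpoint queries m (t : qalg l m) (d : bool) (w : bits l) : seq (bool * 'I_l) :=
  match t with
  | Verdict _ => [::]
  | Round _ Q next =>
    [seq (d, i) | i <- enum Q] ++ queries (next (answers w Q)) (~~ d) w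
  end.

Lemma size_queries m (t : qalg l m) d w : size (queries t d w) = qcount t w.
Proof.
elim: t d => [b|{}m Q next IH] d //=.
by rewrite size_cat size_map IH -cardE.
Qed.

Definition decoded (x y : V) (di : bool * 'I_l) : bool :=
  dec di.1 di.2 (enc di.1 di.2 (inp di.1 x y)) (inp (~~ di.1) x y).

(** If a round is decoded correctly, the next one asks what it would ask on [w]; by induction, the
    simulation never leaves this path and stays within budget. *)
Lemma run_simulate m (t : qalg l m) d c w x y :
  (qcount t w <= c)%N ->
  {in queries t d w, forall di, decoded x y di = w di.2} ->
  run (simulate t d c) x y = qaccepts t w.
Proof.
elim: t d c => [b|{}m Q next IH] d c //= tc ok.
rewrite (leq_trans (leq_addr _ _) tc) !run_send.
rewrite (_ : [ffun i => _] = answers w Q).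
  apply: IH => [|di diq]; last by apply: ok; rewrite mem_cat diq orbT.
  by rewrite leq_subRL // (leq_trans (leq_addr _ _) tc).
apply/ffunP => i; rewrite !ffunE mem_enum; case: ifP => //= iQ; congr Some.
rewrite -(ok (d, i)); last by rewrite mem_cat map_f // mem_enum.
rewrite iQ /decoded /=; congr (dec d i _ _); apply: eq_from_tnth => j.
by rewrite tnth_mktuple ffunE mem_enum !inE iQ.
Qed.

End Simulation.

(** * Error analysis of the simulated tester *)

Lemma has_protocol_of_tester (R : realType) (V : finType) (l k B q : nat)
    (P S : {set V * V}) (Pi : {set bits l}) (eps delta e : R)
    (F : V * V -> bits l) :
  (forall x y, (x, y) \in P :&: S -> F (x, y) \in Pi) ->
  (forall x y, (x, y) \in P :\: S -> far eps Pi (F (x, y))) ->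
  0 <= e ->
  (forall i, has_oneway e (fun x y => F (x, y) i) B) ->
  (forall i, has_oneway e (fun y x => F (x, y) i) B) ->
  has_tester k eps delta Pi q ->
  has_protocol k.+2 (delta + q%:R * e) P S ((B + 1) * q).
Proof.
move=> F_yes F_no e0 toBob toAlice [D [T [Tq Tyes Tno]]].
pose A := ((V -> B.-tuple bool) * (B.-tuple bool -> V -> bool))%type.
pose bad (di : bool * 'I_l) (a : A) (z : V * V) :=
  a.2 (a.1 (inp di.1 z.1 z.2)) (inp (~~ di.1) z.1 z.2) != F z di.2.
have [||D' [f fP]] := @joint_coins R (bool * 'I_l)%type A (V * V)%type _ e bad.
- exact: (fun _ => [tuple false | _ < B], fun _ _ => false).
- move=> [[] i] /=.
    have [D' [enc [dec H]]] := toBob i.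
    by exists D', (fun r => (enc r, dec r)) => -[x y]; apply: H.
  have [D' [enc [dec H]]] := toAlice i.
  by exists D', (fun r => (enc r, dec r)) => -[x y]; apply: H.
pose enc r d i := (f (d, i) r).1; pose dec r d i := (f (d, i) r).2.
exists (prod_coins D D'),
  (fun r => simulate (enc r.2) (dec r.2) (T r.1) true q).
split=> [r|r|x y Pxy].
- exact: cost_simulate.
(* Alice's opening block adds one message to the [k + 1] changes of turn. *)
- apply: leq_trans (messages_prev None true _) _.
  by rewrite ltnS messages_simulate.
pose w := F (x, y).
pose wrong (r : prod_coins D D') := qaccepts (T r.1) w != ((x, y) \in S).
pose misread (r : prod_coins D D') :=
  has (fun di => bad di (f di r.2) (x, y)) (queries (T r.1) true w).
(* A wrong output means that the tester errs on [w] or that a bit it queries on [w] is misread. *)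
apply: (@le_trans _ _ (Pr (fun r => wrong r || misread r))).
  apply: le_Pr => r; apply: contraR; rewrite negb_or => /andP[/negPn/eqP <-].
  move=> /hasPn ok; apply/eqP; apply: run_simulate => // -[d i] /ok.
  by rewrite negbK => /eqP.
apply: le_trans (Pr_or _ _) _; apply: lerD.
  rewrite (Pr_prod_fst D' (fun r => qaccepts (T r) w != ((x, y) \in S))).
  case: (boolP ((x, y) \in S)) => Sxy.
    have wPi : w \in Pi by apply: F_yes; rewrite inE Pxy.
    have := Tyes w wPi; rewrite -(Pr_predC (fun r => qaccepts (T r) w)).
    rewrite lerBlDr lerD2l => /(le_trans _); apply.
    by apply: le_Pr => r; rewrite eqb_id.
  have wfar : far eps Pi w by apply: F_no; rewrite inE Sxy.
  have := Tno w wfar; rewrite -(Pr_predC (fun r => qaccepts (T r) w)).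
  rewrite lerBlDr addrC lerD2l => /(le_trans _); apply.
  by apply: le_Pr => r; rewrite eqbF_neg negbK.
(* With the tester's coins fixed, the list of queries is fixed and the union bound applies over the
   one-way coins. *)
apply: Pr_prod_le => r /=; rewrite /misread /=.
apply: le_trans (Pr_has (e := e) _ _) _ => [di|]; first exact: fP.
by rewrite size_queries ler_wpM2r ?ler_nat.
Qed.

(** * Instantiating the message length and the decoding error *)

Lemma has_oneway_bigmax (R : realType) (n l : nat) (e : R)
    (F : bits n * bits n -> bits l) (i : 'I_l) :
  0 <= e ->
  let B := (\max_(i < l) maxn (CC_to_Bob e (fun xy => F xy i))
                              (CC_to_Alice e (fun xy => F xy i)))%N in
  has_oneway e (fun x y => F (x, y) i) B /\ has_oneway e (fun y x => F (x, y) i) B.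
Proof.
move=> e0 B.
have : (maxn (CC_to_Bob e (fun xy => F xy i))
             (CC_to_Alice e (fun xy => F xy i)) <= B)%N.
  exact: (leq_bigmax (F := fun i => maxn (CC_to_Bob e (fun xy => F xy i))
                                         (CC_to_Alice e (fun xy => F xy i)))).
rewrite geq_max => /andP[leBob leAlice]; split.
  apply: has_oneway_widen leBob _.
  exact: (natminP (has_oneway_exists _ e0)).1.
apply: has_oneway_widen leAlice _.
exact: (natminP (has_oneway_exists _ e0)).1.
Qed.

Theorem theorem6p5 (R : realType) (n l k : nat)
    (P S : {set bits n * bits n}) (Pi : {set bits l}) (eps delta : R)
    (F : bits n * bits n -> bits l)
    (eps_gt0 : 0 < eps) (delta_gt0 : 0 < delta)
    (F_yes : forall x y, (x, y) \in P :&: S -> F (x, y) \in Pi)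
    (F_no : forall x y, (x, y) \in P :\: S -> far eps Pi (F (x, y))) :
  (let B := (\max_(i < l) maxn (CC_to_Bob (delta / n%:R) (fun xy => F xy i))
                               (CC_to_Alice (delta / n%:R) (fun xy => F xy i)))%N in
   1 / (B + 1)%:R * (CC k.+2 (2 * delta) P S)%:R
     <= (query_complexity k eps delta Pi)%:R :> R)
  /\
  (let B' := (\max_(i < l) maxn (CC_to_Bob (0 : R) (fun xy => F xy i))
                                (CC_to_Alice (0 : R) (fun xy => F xy i)))%N in
   1 / (B' + 1)%:R * (CC k.+2 delta P S)%:R
     <= (query_complexity k eps delta Pi)%:R :> R).
Proof.
have delta_ge0 := ltW delta_gt0.
have qP : has_tester k eps delta Pi (query_complexity k eps delta Pi).
  exact: (natminP (has_tester_exists k Pi eps_gt0 delta_ge0)).1.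
set q := query_complexity k eps delta Pi in qP *.
have bound (B c : nat) : (c <= (B + 1) * q)%N ->
    1 / (B + 1)%:R * c%:R <= q%:R :> R.
  move=> cq; rewrite div1r mulrC ler_pdivrMr ?ltr0n ?addn1 //.
  by rewrite -natrM ler_nat mulnC -addn1.
have simulation e B : 0 <= e ->
    (forall i, has_oneway e (fun x y => F (x, y) i) B /\
               has_oneway e (fun y x => F (x, y) i) B) ->
    has_protocol k.+2 (delta + q%:R * e) P S ((B + 1) * q).
  move=> e0 ow; apply: has_protocol_of_tester F_yes F_no e0 _ _ qP => i.
    by case: (ow i).
  by case: (ow i).
split=> B; apply: bound.
  (* If [n < q], the trivial protocol costs [n + 1 <= q]; otherwise the union bound adds at most
     [delta]. *)
  have [nq|qn] := ltnP n q.
    have H : has_protocol k.+2 (2 * delta) P S n.+1.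
      by apply: has_protocol_exists; rewrite mulr_ge0.
    apply: (leq_trans ((natminP H).2 _ H)).
    by rewrite (leq_trans nq) // addn1 leq_pmull.
  have e0 : 0 <= delta / n%:R by rewrite divr_ge0.
  have qe : delta + q%:R * (delta / n%:R) <= 2 * delta.
    rewrite [leRHS]mulr_natl mulr2n lerD2l mulrCA ler_piMr //.
    (* For [n = 0] the convention that [0] has inverse [0] makes the ratio vanish. *)
    have [->|n0] := posnP n; first by rewrite invr0 mulr0.
    by rewrite ler_pdivrMr ?ltr0n // mul1r ler_nat.
  have H := simulation _ B e0 (fun i => has_oneway_bigmax F i e0).
  have H' := has_protocol_weaken qe H.
  exact: (natminP H').2.
(* Zero-error decoding adds nothing to [delta], so [q] and [n] need not be compared. *)
have := simulation _ B (lexx 0) (fun i => has_oneway_bigmax F i (lexx 0)).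
by rewrite mulr0 addr0 => H; apply: (natminP H).2.
Qed.
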